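(* For $i \in \{1, 2\}$, let $X_i \subset \mathbb R^{d_i}$ be an open set, let $m$ be a positive integer, and let $g\colon X_1 \to X_2$. (a) The following assertions are equivalent. (a-i) For every $f \in L^\infty(X_2, \mathbb R^m)$, we have $f \circ g \in L^\infty(X_1, \mathbb R^m)$. (a-ii) The function $g$ is $(\mathfrak L, \mathfrak L)$-measurable and the measure $g_\# \mathcal L$ is absolutely continuous with respect to $\mathcal L$. (b) Assume further that $\mathcal L(X_1) < +\infty$ and take $p \in [1, +\infty)$. Then the following assertions are equivalent. (b-i) For every $f \in L^p(X_2, \mathbb R^m)$, we have $f \circ g \in L^p(X_1, \mathbb R^m)$. (b-ii) The function $g$ is $(\mathfrak L, \mathfrak L)$-measurable, the measure $g_\# \mathcal L$ is absolutely continuous with respect to $\mathcal L$, and the Radon--Nikodym derivative of $g_\# \mathcal L$ with respect to $\mathcal L$ is bounded.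
   Context: $\mathfrak L$ and $\mathfrak B$ denote the Lebesgue and Borel $\sigma$-algebras on a Euclidean space or on a measurable subset of it; $\mathcal L$ is Lebesgue measure (restricted to $X_1$ or $X_2$ as appropriate). A map $g\colon X\to Y$ is $(\mathfrak S_X, \mathfrak S_Y)$-measurable if $g^{-1}(B) \in \mathfrak S_X$ for every $B \in \mathfrak S_Y$. $g_\#\mathcal L$ is the push-forward measure $B \mapsto \mathcal L(g^{-1}(B))$ on $(X_2, \mathfrak L)$. $d_1, d_2$ are positive integers. Elements of $L^q$, $q \in [1, +\infty]$, are equivalence classes, modulo a.e. equality, of $(\mathfrak L, \mathfrak B)$-measurable functions. The assertion ''for every $f \in L^q(X_2, \mathbb R^m)$, $f\circ g \in L^q(X_1, \mathbb R^m)$'' means: for every function $f\colon X_2 \to \mathbb R^m$ representing an element of $L^q(X_2, \mathbb R^m)$, the composition $f \circ g$ is $(\mathfrak L, \mathfrak B)$-measurable and represents an element of $L^q(X_1, \mathbb R^m)$, and this element depends only on the class of $f$ (i.e. $\widetilde f = f$ a.e. in $X_2$ implies $\widetilde f \circ g = f \circ g$ a.e. in $X_1$). ''Bounded'' for the Radon--Nikodym derivative means that it belongs to $L^\infty$. *)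

(* Defs.v *)
From HB Require Import structures.
From mathcomp Require Import all_boot all_order all_algebra.
From mathcomp Require Import all_classical all_reals all_analysis.
From mathcomp Require Import measurable_realfun.

Set Implicit Arguments.
Unset Strict Implicit.
Unset Printing Implicit Defensive.
Import Order.TTheory GRing.Theory Num.Theory.
Import numFieldNormedType.Exports.

Local Open Scope classical_set_scope.
Local Open Scope ring_scope.

Section lebesgue_outer.
Context {R : realType} {d : nat}.
Implicit Types (a b : 'rV[R]_d) (A : set 'rV[R]_d).

Definition box a b : set 'rV[R]_d :=
  [set x | forall i, a ord0 i < x ord0 i <= b ord0 i].

Definition box_volume a b : R :=
  \prod_(i < d) Num.max 0 (b ord0 i - a ord0 i).

(* Coverings are countable sets of boxes rather than sequences, so that the
   empty set has the empty covering in every dimension, 0 included. *)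
Definition lebesgue_outer A : \bar R :=
  ereal_inf [set (\esum_(c in C) (box_volume c.1 c.2)%:E)%E | C in
    [set C : set ('rV[R]_d * 'rV[R]_d) |
      countable C /\ A `<=` \bigcup_(c in C) box c.1 c.2]].

Lemma box_volume_ge0 a b : 0 <= box_volume a b.
Proof. by apply: prodr_ge0 => i _; rewrite le_max lexx. Qed.

Lemma lebesgue_outer0 : lebesgue_outer set0 = 0%E.
Proof.
apply/eqP; rewrite eq_le; apply/andP; split.
  apply: ereal_inf_lbound; exists set0; first by split.
  by rewrite esum_set0.
apply: le_ereal_inf_tmp => _ [C _ <-]; apply: esum_ge0 => c _.
by rewrite lee_fin box_volume_ge0.
Qed.

Lemma lebesgue_outer_ge0 A : (0 <= lebesgue_outer A)%E.
Proof.
apply: le_ereal_inf_tmp => _ [C _ <-]; apply: esum_ge0 => c _.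
by rewrite lee_fin box_volume_ge0.
Qed.

Lemma le_lebesgue_outer : {homo lebesgue_outer : A B / A `<=` B >-> (A <= B)%E}.
Proof.
move=> A B AB; apply: ereal_inf_le_tmp => _ [C [cC BC] <-].
by exists C => //; split=> //; exact: subset_trans BC.
Qed.

Lemma lebesgue_outer_sigma_subadditive : sigma_subadditive lebesgue_outer.
Proof.
pose w (c : 'rV[R]_d * 'rV[R]_d) : \bar R := (box_volume c.1 c.2)%:E.
have w_ge0 c : (0 <= w c)%E by rewrite lee_fin box_volume_ge0.
move=> A; have [[i ioo]|] := pselect (exists i, lebesgue_outer (A i) = +oo%E).
  rewrite (eseries_pinfty _ _ ioo) ?leey// => n _.
  by rewrite -ltNye (lt_le_trans _ (lebesgue_outer_ge0 _)).
rewrite -forallNE => Aoo.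
apply/lee_addgt0Pr => _/posnumP[e].
rewrite (le_trans _ (epsilon_trick _ _ _))//; last first.
  by move=> n; exact: lebesgue_outer_ge0.
have /choice[C HC] n : exists C : set ('rV[R]_d * 'rV[R]_d), [/\ countable C,
    A n `<=` \bigcup_(c in C) box c.1 c.2 &
    (\esum_(c in C) w c <= lebesgue_outer (A n) + (e%:num / (2 ^ n.+1)%:R)%:E)%E].
  have fin : lebesgue_outer (A n) \is a fin_num.
    by rewrite ge0_fin_numE ?lebesgue_outer_ge0// ltey; exact/eqP/Aoo.
  have en1 : 0 < e%:num / (2 ^ n.+1)%:R by [].
  have [_ [C [cC AC] <-] lt] := lb_ereal_inf_adherent en1 fin.
  by exists C; split => //; exact: ltW.
apply: (@le_trans _ _ (\esum_(c in \bigcup_n C n) w c)%E).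
  apply: ereal_inf_lbound; exists (\bigcup_n C n) => //; split.
    by apply: bigcup_countable => // n _; have [] := HC n.
  move=> x [n _ /(let: And3 _ h _ := HC n in h) [c Cc xc]].
  by exists c => //; exists n.
rewrite seqDU_bigcup_eq esum_bigcupT//.
rewrite nneseries_esumT//; last first.
  move=> n; apply: adde_ge0; first exact: lebesgue_outer_ge0.
  by rewrite lee_fin divr_ge0.
apply: le_esum => n _; have [_ _] := HC n; apply: le_trans.
apply: ge_ereal_sup => _ [F [fF FC] <-]; apply: ereal_sup_ubound.
by exists F => //; split => //; exact: subset_trans FC (@subset_seqDU _ _ _).
Qed.

HB.instance Definition _ := isOuterMeasure.Build R 'rV[R]_d lebesgue_outer
  lebesgue_outer0 lebesgue_outer_ge0 le_lebesgue_outer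
  lebesgue_outer_sigma_subadditive.

End lebesgue_outer.

Definition lebesgue_outer_measure (R : realType) (d : nat) :
  {outer_measure set 'rV[R]_d -> \bar R} := @lebesgue_outer R d.

(* The Lebesgue sigma-algebra, as the Caratheodory-measurable sets of the
   outer measure; 'rV[R]_d itself carries no measurable structure. *)
Definition lebesgue_space (R : realType) (d : nat) :=
  caratheodory_type (lebesgue_outer_measure R d).

HB.instance Definition _ R d := Measurable.on (lebesgue_space R d).

Definition lebesgue {R : realType} {d : nat} :
  set (lebesgue_space R d) -> \bar R := lebesgue_outer_measure R d.

HB.instance Definition _ (R : realType) (d : nat) :=
  Measure.on (@lebesgue R d).

(* The Borel sigma-algebra; the sort is again 'rV[R]_m. *)
Definition borel_space (R : realType) (m : nat) :=
  g_sigma_algebraType (@open 'rV[R]_m).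

HB.instance Definition _ R m := Measurable.on (borel_space R m).

(* The library's norm on 'rV[R]_m is the sup norm. *)
Definition euclidean_norm {R : realType} {m : nat} (y : 'rV[R]_m) : R :=
  Num.sqrt (\sum_(i < m) y ord0 i ^+ 2).

(* A map defined on a subset X of 'rV[R]_d is represented by a total function,
   all notions below depending only on its values on X. A Lebesgue subset of X
   is the trace on X of a Lebesgue subset of 'rV[R]_d. *)
Section on_subset.
Context {R : realType}.

Definition LL_measurable {d1 d2 : nat} (X : set 'rV[R]_d1)
    (g : 'rV[R]_d1 -> 'rV[R]_d2) : Prop :=
  measurable_fun (X : set (lebesgue_space R d1)) (g : _ -> lebesgue_space R d2).

Definition LB_measurable {d m : nat} (X : set 'rV[R]_d)
    (f : 'rV[R]_d -> 'rV[R]_m) : Prop :=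
  measurable_fun (X : set (lebesgue_space R d)) (f : _ -> borel_space R m).

Definition lebesgue_on {d : nat} (X : set 'rV[R]_d)
    (A : set (lebesgue_space R d)) : \bar R :=
  lebesgue (A `&` X).

Definition pushforward_on {d1 d2 : nat} (X : set 'rV[R]_d1)
    (g : 'rV[R]_d1 -> 'rV[R]_d2) : set (lebesgue_space R d2) -> \bar R :=
  pushforward (lebesgue_on X) (g : lebesgue_space R d1 -> lebesgue_space R d2).

Definition ae_eq_on {d : nat} {V : Type} (X : set 'rV[R]_d)
    (f f' : 'rV[R]_d -> V) : Prop :=
  f = f' %[ae lebesgue in X].

(* The L^q norm over X is that of the extension by 0 outside X. *)
Definition Lq_norm_on {d : nat} (X : set 'rV[R]_d) (q : \bar R)
    (h : 'rV[R]_d -> \bar R) : \bar R :=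
  'N[lebesgue]_q[h \_ X].

(* f represents an element of L^q(X, R^m). *)
Definition Lq_on {d m : nat} (X : set 'rV[R]_d) (q : \bar R)
    (f : 'rV[R]_d -> 'rV[R]_m) : Prop :=
  LB_measurable X f /\
  (Lq_norm_on X q (fun x => (euclidean_norm (f x))%:E) < +oo)%E.

(* f \o g is in L^q(X1, R^m) for every f in L^q(X2, R^m), as classes. *)
Definition comp_Lq {d1 d2 : nat} (m : nat) (X1 : set 'rV[R]_d1)
    (X2 : set 'rV[R]_d2) (q : \bar R) (g : 'rV[R]_d1 -> 'rV[R]_d2) : Prop :=
  forall f : 'rV[R]_d2 -> 'rV[R]_m, Lq_on X2 q f ->
    Lq_on X1 q (f \o g) /\
    forall f' : 'rV[R]_d2 -> 'rV[R]_m,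
      ae_eq_on X2 f' f -> ae_eq_on X1 (f' \o g) (f \o g).

(* h is a version of the Radon-Nikodym derivative on X of nu with respect to
   the Lebesgue measure; stated as a predicate because the library's
   'd nu '/d mu takes a bundled finite charge nu, whereas a push-forward is a
   measure only when the map is known to be measurable. *)
Definition is_Radon_Nikodym {d : nat} (X : set 'rV[R]_d)
    (nu : set (lebesgue_space R d) -> \bar R) (h : 'rV[R]_d -> \bar R) : Prop :=
  [/\ measurable_fun (X : set (lebesgue_space R d)) (h : lebesgue_space R d -> \bar R),
    forall x, X x -> (0 <= h x)%E &
    forall B : set (lebesgue_space R d), measurable B -> B `<=` X ->
      nu B = (\int[lebesgue]_(x in B) h x)%E].

End on_subset.

(* Main.v *)
From HB Require Import structures.
Require Import Defs.
From mathcomp Require Import all_boot all_order all_algebra.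
From mathcomp Require Import all_classical all_reals all_analysis.
From mathcomp Require Import measurable_realfun.
From mathcomp Require Import lra ess_sup_inf.

(* Applying (i) to the indicator functions of sets of finite measure, which
   exhaust the sigma-algebra since Lebesgue measure is sigma-finite, shows that
   g is (L, L)-measurable; independence of the representative, applied to the
   indicator of a null set, is absolute continuity of nu := g_# L.
   In (b), the change of variables \int_X1 phi \o g = \int phi dnu turns (b-i)
   into the inclusion of L^1(L) in L^1(nu). A gliding-hump function shows that
   this forces nu <= C L for some constant C, which means that the
   Radon-Nikodym derivative is bounded; conversely nu <= C L gives
   \int phi dnu <= C \int phi. *)

Set Implicit Arguments.
Unset Strict Implicit.
Unset Printing Implicit Defensive.
Import Order.TTheory GRing.Theory Num.Theory.
Import numFieldNormedType.Exports.

Local Open Scope classical_set_scope.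
Local Open Scope ring_scope.

(** * Coverings by boxes; measurability of half-spaces, boxes and open sets *)

(** Choosing one preimage in [C] of each point of the image turns the left sum into a sum over a
    subset of [C]. *)
Lemma esum_image_le (R : realType) (T T' : choiceType) (C : set T) (f : T -> T')
    (a : T' -> \bar R) :
  (\esum_(j in f @` C) a j <= \esum_(i in C) a (f i))%E.
Proof.
have [->|/set0P[x0 Cx0]] := eqVneq C set0.
  by rewrite image_set0 !esum_set0.
have /choice[s sP] (y : T') : exists x : T, (f @` C) y -> C x /\ f x = y.
  have [[z Cz zy]|nCy] := pselect ((f @` C) y); last by exists x0.
  by exists z => _; split.
rewrite (@eq_esum _ _ _ _ (fun y => a (f (s y)))); last first.
  by move=> y /sP[_ ->].
rewrite -(@esum_image _ _ _ (f @` C) s (a \o f)); last first.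
  by move=> x y /set_mem/sP[_ {2}<-] /set_mem/sP[_ {2}<-] ->.
apply: ge_ereal_sup => _ [F [fF FC] <-]; apply: ereal_sup_ubound.
by exists F => //; split=> // x /FC[y /sP[? _] <-].
Qed.

Section lebesgue_basics.
Context {R : realType} {d : nat}.
Implicit Types (a b : 'rV[R]_d) (A : set 'rV[R]_d).
Local Notation mu := (@lebesgue R d).

(** Allows coverings indexed by [C] with repetitions: cutting distinct boxes may produce equal
    pieces, which a set of boxes counts only once. *)
Lemma lebesgue_outer_le_cover (C : set ('rV[R]_d * 'rV[R]_d)) A
    (f : 'rV[R]_d * 'rV[R]_d -> 'rV[R]_d * 'rV[R]_d) :
  countable C -> A `<=` \bigcup_(c in C) box (f c).1 (f c).2 ->
  (lebesgue_outer A <= \esum_(c in C) (box_volume (f c).1 (f c).2)%:E)%E.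
Proof.
move=> cC AC; apply: (@le_trans _ _
    (\esum_(c in f @` C) (box_volume c.1 c.2)%:E)%E).
  apply: ereal_inf_lbound; exists (f @` C) => //; split.
    exact: sub_countable (card_image_le _ _) cC.
  by move=> x /AC[c Cc xc]; exists (f c) => //; exists c.
exact: esum_image_le.
Qed.

(* A hyperplane cuts a box into two boxes whose volumes add up. *)
Lemma caratheodory_halfspace (i : 'I_d) (t : R) :
  (lebesgue_outer_measure R d).-caratheodory [set x | x ord0 i <= t].
Proof.
apply: le_caratheodory_measurable => X /=.
apply: le_ereal_inf_tmp => _ [C [cC XC] <-].
pose lo (c : 'rV[R]_d * 'rV[R]_d) : 'rV[R]_d * 'rV[R]_d :=
  (c.1, \row_j if j == i then Num.min (c.2 ord0 j) t else c.2 ord0 j).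
pose hi (c : 'rV[R]_d * 'rV[R]_d) : 'rV[R]_d * 'rV[R]_d :=
  (\row_j (if j == i then Num.max (c.1 ord0 j) t else c.1 ord0 j), c.2).
have -> : \esum_(c in C) (box_volume c.1 c.2)%:E =
    (\esum_(c in C) (box_volume (lo c).1 (lo c).2)%:E +
     \esum_(c in C) (box_volume (hi c).1 (hi c).2)%:E)%E.
  rewrite -esumD; [|by move=> c _; rewrite lee_fin box_volume_ge0..].
  apply: eq_esum => -[a b] _; rewrite -EFinD; congr EFin => /=.
  (* Only the factor of index [i] changes, so the claim is max(0, b-a) = max(0, min(b,t)-a) + max(0,
     b-max(a,t)) for the [i]-th coordinates. *)
  rewrite /box_volume (bigD1 i)//= [X in _ = X + _](bigD1 i)//=.
  rewrite [X in _ = _ + X](bigD1 i)//= !mxE eqxx.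
  under [X in _ = _ * X + _]eq_bigr => j /negbTE ji do rewrite mxE ji.
  under [X in _ = _ + _ * X]eq_bigr => j /negbTE ji do rewrite mxE ji.
  rewrite -mulrDl; congr (_ * _).
  case: (leP (b ord0 i) t) => ?; case: (leP (a ord0 i) t) => ?;
    do !case: (leP 0) => ?; lra.
apply: leeD; apply: lebesgue_outer_le_cover => //.
  move=> x [/XC[c Cc xc] xt]; exists c => // j; rewrite !mxE.
  by have /andP[-> xb] := xc j; case: eqP => // ji; rewrite le_min xb ji xt.
move=> x [/XC[c Cc xc] /negP xt]; exists c => // j; rewrite !mxE.
have /andP[ax ->] := xc j; case: eqP => [ji|]; rewrite ?ax//.
by rewrite gt_max ax ji ltNge xt.
Qed.

Lemma measurable_halfspace (i : 'I_d) (t : R) :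
  measurable ([set x | x ord0 i <= t] : set (lebesgue_space R d)).
Proof. exact: caratheodory_halfspace. Qed.

Lemma measurable_box a b : measurable (box a b : set (lebesgue_space R d)).
Proof.
rewrite (_ : box a b = \bigcap_(i in [set: 'I_d])
    ([set x : lebesgue_space R d | x ord0 i <= b ord0 i] `\`
     [set x : lebesgue_space R d | x ord0 i <= a ord0 i])).
  apply: fin_bigcap_measurable => // i _.
  by apply: measurableD; exact: measurable_halfspace.
apply/seteqP; split=> [x xab i _ /=|x xab i].
  by have /andP[ax ->] := xab i; split => //; rewrite leNgt ax.
by have [/= -> /negP] := xab i Logic.I; rewrite -ltNge => ->.
Qed.

Lemma lebesgue_box_lty a b : (mu (box a b) < +oo)%E.
Proof.
apply: (@le_lt_trans _ _ (box_volume a b)%:E); last exact: ltry.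
have := @lebesgue_outer_le_cover [set (a, b)] (box a b) id (countable1 _).
rewrite esum_set1 ?lee_fin ?box_volume_ge0//; apply.
by move=> x xab; exists (a, b).
Qed.

Lemma lebesgue_sigma_finite : sigma_finite setT mu.
Proof.
exists (fun n => box (const_mx (- n%:R)) (const_mx n%:R)); last first.
  by move=> n; split; [exact: measurable_box|exact: lebesgue_box_lty].
apply/seteqP; split=> // x _.
pose M := \sum_j `|x ord0 j|.
have x_le i : `|x ord0 i| <= M by rewrite /M (bigD1 i)//= lerDl sumr_ge0.
exists (Num.truncn M).+1 => // i; rewrite !mxE.
have := le_lt_trans (x_le i) (truncnS_gt M).
by rewrite ltr_norml => /andP[-> /ltW].
Qed.

(** Balls of the sup norm are cubes, so each point of [A] lies in a box with rational corners
    contained in [A], and there are countably many such boxes. *)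
Lemma open_lebesgue_measurable A :
  open A -> measurable (A : set (lebesgue_space R d)).
Proof.
move=> oA.
pose rV (p : 'rV[rat]_d) : 'rV[R]_d := map_mx ratr p.
pose B (p : 'rV[rat]_d * 'rV[rat]_d) := box (rV p.1) (rV p.2).
rewrite (_ : A = \bigcup_p (if `[< B p `<=` A >] then B p else set0)).
  apply: countable_bigcupT_measurable => [|p]; first exact: countableP.
  by case: ifPn => _ //; exact: measurable_box.
apply/seteqP; split=> [x Ax|x [p _]]; last first.
  by case: asboolP => // BA; exact: BA.
have /nbhs_ballP[e /= e0 xeA] : nbhs x A by exact: open_nbhs_nbhs.
have /choice[p pP] (i : 'I_d) : exists q : rat, x ord0 i - e < ratr q < x ord0 i.
  have /rat_in_itvoo[q] : x ord0 i - e < x ord0 i by rewrite ltrBlDr ltrDl.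
  by rewrite in_itv; exists q.
have /choice[q qP] (i : 'I_d) : exists q : rat, x ord0 i < ratr q < x ord0 i + e.
  have /rat_in_itvoo[q] : x ord0 i < x ord0 i + e by rewrite ltrDl.
  by rewrite in_itv; exists q.
exists (\row_i p i, \row_i q i) => //; case: asboolP => [_|[]].
  move=> i; rewrite !mxE; have /andP[_ ->] := pP i.
  by have /andP[/ltW ->] := qP i.
move=> y yB; apply: xeA; split => // i j; rewrite !ord1.
have := yB j; rewrite !mxE; have := pP j; have := qP j.
rewrite /ball/= ltr_norml => /andP[? ?] /andP[? ?] /andP[? ?].
by apply/andP; split; lra.
Qed.
End lebesgue_basics.

HB.instance Definition _ (R : realType) (d : nat) :=
  Measure_isSigmaFinite.Build _ _ _ (@lebesgue R d)
    (@lebesgue_sigma_finite R d).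

(** * Borel measurability in the target space *)

Section borel_space.
Context {R : realType} {m : nat}.

Lemma measurable_into_borel (f : R -> 'rV[R]_m) :
  continuous f -> measurable_fun setT (f : R -> borel_space R m).
Proof.
move=> /continuousP cf.
apply: (@measurability _ _ R (borel_space R m) _ f (@open 'rV[R]_m)) => //.
move=> _ [U oU <-].
by rewrite setTI; apply: open_measurable; exact: cf.
Qed.

Lemma measurable_from_borel (f : 'rV[R]_m -> R) :
  continuous f -> measurable_fun setT (f : borel_space R m -> R).
Proof.
move=> /continuousP cf.
apply: (measurability (@RGenOpens.G R) (RGenOpens.measurableE R)) => //.
move=> _ [_ [a [b ->] <-]].
by rewrite setTI; apply: sub_sigma_algebra; apply: cf; exact: interval_open.
Qed.

Lemma measurable_euclidean_norm :
  measurable_fun setT (euclidean_norm : borel_space R m -> R).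
Proof.
apply: (@measurableT_comp _ _ _ _ _ _ (@Num.sqrt R)).
  by apply: continuous_measurable_fun => x; exact: sqrt_continuous.
apply: measurable_sum => i; apply: measurable_funX.
by apply: measurable_from_borel => y; exact: coord_continuous.
Qed.

(** Scalar test functions are placed on one coordinate axis of the target; this keeps their absolute
    value as the norm. *)
Lemma euclidean_norm_scale_delta (i : 'I_m) (t : R) :
  euclidean_norm (t *: delta_mx ord0 i : 'rV[R]_m) = `|t|.
Proof.
rewrite /euclidean_norm (bigD1 i)//= big1 => [|j ji].
  by rewrite !mxE !eqxx mulr1 addr0 sqrtr_sqr.
by rewrite !mxE (negbTE ji) andbF mulr0 expr0n.
Qed.

Lemma euclidean_norm_ge0 (y : 'rV[R]_m) : 0 <= euclidean_norm y.
Proof. exact: sqrtr_ge0. Qed.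

End borel_space.

(** * Domination of measures from inclusion of integrable functions *)

(* Otherwise choose A_k with nu A_k > (k+1) 2^(k+1) mu A_k: the function
   \sum_k 2^-(k+1) (mu A_k)^-1 1_(A_k) is mu-integrable but not nu-integrable. *)
Lemma measure_le_mscale d (T : measurableType d) (R : realType)
    (mu nu : {measure set T -> \bar R}) :
  (nu setT < +oo)%E -> nu `<< mu ->
  (forall f : T -> R, measurable_fun setT f -> (forall x, 0 <= f x) ->
    (\int[mu]_x (f x)%:E < +oo -> \int[nu]_x (f x)%:E < +oo)%E) ->
  exists C : {nonneg R}, forall A, measurable A -> (nu A <= C%:num%:E * mu A)%E.
Proof.
move=> nuT numu L1; apply: contrapT => noC.
(* The factor 2^(k+1) will make the mu-integrals summable, while the factor k+1 survives in the
   nu-integrals. *)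
pose c k : R := k.+1%:R * (2 ^ k.+1)%:R.
have c_gt0 k : 0 < c k by rewrite mulr_gt0 ?ltr0n ?expn_gt0.
have c0 k : 0 <= c k by exact: ltW.
have /choice[A AP] k : exists A, measurable A /\ ((c k)%:E * mu A < nu A)%E.
  apply: contrapT => nA; apply: noC; exists (NngNum (c0 k)) => A mA /=.
  by rewrite leNgt; apply/negP => ltA; apply: nA; exists A.
have mA k : measurable (A k) by case: (AP k).
have nuA k : (nu (A k) < +oo)%E.
  by rewrite (le_lt_trans _ nuT)// le_measure ?inE.
(* The measure of [A k] can be divided by: if it were 0, absolute continuity would give nu(A_k) = 0;
   if infinite, nu(A_k) would exceed infinity. *)
have muA0 k : (0 < mu (A k))%E.
  rewrite lt0e measure_ge0 andbT; apply/negP => /eqP muA.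
  have [_] := AP k; rewrite muA mule0.
  by move/null_content_dominatesP : numu => /(_ _ (mA k) muA) ->; rewrite ltxx.

have muAfin k : mu (A k) \is a fin_num.
  rewrite ge0_fin_numE//; have [_ /lt_trans/(_ (nuA k))] := AP k.
  by rewrite !ltey; apply: contraNN => /eqP->; rewrite gt0_muley ?lte_fin.
have muAn0 k : fine (mu (A k)) != 0.
  by rewrite gt_eqF// fine_gt0// muA0 ltey_eq muAfin.
pose a k : R := (2 ^ k.+1)%:R^-1 / fine (mu (A k)).
have a0 k : 0 <= a k by rewrite divr_ge0 ?invr_ge0 ?ler0n ?fine_ge0.
pose u k (x : T) : \bar R := (a k * \1_(A k) x)%:E.
have u0 k x : (0 <= u k x)%E by rewrite lee_fin mulr_ge0.
have mu_ k : measurable_fun setT (u k).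
  by apply/measurable_EFinP; apply: measurable_funM => //; exact: measurable_indic.
have intu (rho : {measure set T -> \bar R}) k :
    (\int[rho]_x u k x = (a k)%:E * rho (A k))%E.
  rewrite /u; under eq_integral do rewrite EFinM.
  rewrite ge0_integralZl ?lee_fin//; first by rewrite integral_indic ?setIT.
  by apply/measurable_EFinP; exact: measurable_indic.
pose F x := (\sum_(k <oo) u k x)%E.
have F0 x : (0 <= F x)%E by apply: nneseries_ge0 => k _ _; exact: u0.
have mF : measurable_fun setT F.
  by apply: (ge0_emeasurable_sum (P := xpredT)) => // k _; exact: mu_.
have muF : (\int[mu]_x F x < +oo)%E.
  rewrite integral_nneseries//; apply: (@le_lt_trans _ _ 1%:E); last exact: ltry.
  apply: le_trans (epsilon_trick0 xpredT ler01).
  apply: lee_nneseries => k _; first by rewrite intu mule_ge0 ?lee_fin.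
  by rewrite intu /a -[X in (_ * X)%E]fineK// -EFinM lee_fin divfK// div1r.
(* The hypothesis [L1] concerns real-valued functions, so [F] is replaced by [fine \o F], which
   equals it mu-a.e. and hence nu-a.e. *)
have Ffin : \forall x \ae mu, F x \is a fin_num.
  have Fint : mu.-integrable setT F.
    by apply/integrableP; split => //; under eq_integral do rewrite gee0_abs//.
  by have := integrable_ae measurableT Fint; apply: filterS => x; apply.
have fF x : ((fine (F x))%:E <= F x)%E.
  by case: (F x) (F0 x) => [r| |]//= _; rewrite leey.
have mfine : measurable_fun setT (fine \o F) by exact: measurableT_comp.
have : (\int[nu]_x (fine (F x))%:E < +oo)%E.
  apply: L1 => //; first by move=> x; exact: fine_ge0.
  apply: le_lt_trans muF; apply: ge0_le_integral => //.
  - by move=> x _; rewrite lee_fin fine_ge0.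
  - exact/measurable_EFinP.
rewrite (@ae_eq_integral _ _ _ nu setT F)//; last 2 first.
- exact/measurable_EFinP.
- apply: (null_dominates_ae_eq measurableT numu).
  by apply: filterS Ffin => x Fx _; rewrite fineK.
(* The single term [u k] already has nu-integral at least k+1, for every k. *)
have nuF k : (k.+1%:R%:E <= \int[nu]_x F x)%E.
  apply: (@le_trans _ _ (\int[nu]_x u k x)%E); last first.
    apply: ge0_le_integral => // x _.
    rewrite /F (@nneseriesD1 _ _ k)//; apply: leeDl; exact: nneseries_ge0.
  rewrite intu; have [_ /ltW] := AP k.
  have aE0 : (0 <= (a k)%:E)%E by rewrite lee_fin.
  move=> /(lee_wpmul2l aE0); apply: le_trans.
  rewrite -[X in (_ * (_ * X))%E]fineK// -!EFinM lee_fin.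
  rewrite /a /c mulrCA divfK//.
  by rewrite mulfK // pnatr_eq0 -lt0n expn_gt0.
move=> Foo; have Ffn : (\int[nu]_x F x)%E \is a fin_num.
  by rewrite ge0_fin_numE// integral_ge0.
have := nuF (Num.truncn (fine (\int[nu]_x F x)%E)).
by rewrite -[leRHS]fineK// lee_fin leNgt truncnS_gt.
Qed.

(** * Restricted measures and finiteness of L^q norms *)

(** The complement of [D] is null for the restricted measure, and both measures agree on subsets of
    [D]. *)
Lemma ge0_integral_mrestr d (T : measurableType d) (R : realType)
    (mu : {measure set T -> \bar R}) (D : set T) (mD : measurable D)
    (f : T -> \bar R) : measurable_fun setT f -> (forall x, 0 <= f x)%E ->
  (\int[mrestr mu mD]_x f x = \int[mu]_(x in D) f x)%E.
Proof.
move=> mf f0; rewrite (@ge0_negligible_integral _ _ _ (mrestr mu mD) setT (~` D))//.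
- rewrite setTD setCK; apply: eq_measure_integral => A mA AD.
  by rewrite /= /mrestr setIidl.
- exact: measurableC.
- by rewrite /= /mrestr setICl measure0.
Qed.

Lemma Lnorm_infty_ltyP d (T : measurableType d) (R : realType)
    (mu : {measure set T -> \bar R}) (f : T -> \bar R) :
  ('N[mu]_+oo[f] < +oo)%E <->
  exists M : R, \forall x \ae mu, (`|f x| <= M%:E)%E.
Proof.
(* On a space of measure zero the norm is 0 by convention, and every bound holds a.e. *)
rewrite unlock /=; case: ifPn => [muT|]; last first.
  rewrite -leNgt measure_le0 => /eqP muT; split=> _; last exact: ltry.
  by exists 0; exact: measure0_ae.
split=> [foo|[M fM]].
  exists (fine (ess_sup mu (abse \o f))); rewrite fineK; first exact: ess_sup_ge.
  rewrite ge0_fin_numE//; apply: ess_sup_gee => //.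
  by apply: nearW => x; exact: abse_ge0.
by apply: (@le_lt_trans _ _ M%:E); [exact/ess_supP|exact: ltry].
Qed.

Lemma Lnorm_fin_ltyP d (T : measurableType d) (R : realType)
    (mu : {measure set T -> \bar R}) (p : R) (f : T -> \bar R) : 0 < p ->
  ('N[mu]_p%:E[f] < +oo)%E <-> (\int[mu]_x (`|f x| `^ p) < +oo)%E.
Proof.
move=> p0; rewrite unlock; split; last exact: poweR_lty.
by apply: lty_poweRy; rewrite invr_neq0// gt_eqF.
Qed.

#[local] Instance lebesgue_ae_filter (R : realType) (d : nat) :
  Filter (nbhs (almost_everywhere (@lebesgue R d))).
Proof. exact: (ae_filter_ringOfSetsType (@lebesgue R d)). Qed.

(** * Push-forward and L^q norms for maps defined on a subset *)

Section on_subset.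
Context {R : realType}.

(** Bundles the set function [pushforward_on X g] as a measure, with change of variables. Since [g]
    is measurable only on [X], it is made constant outside; the restriction of Lebesgue measure to
    [X] does not see the change. *)
Lemma LL_measurable_pushforward d1 d2 (X : set 'rV[R]_d1)
    (g : 'rV[R]_d1 -> 'rV[R]_d2) :
  measurable (X : set (lebesgue_space R d1)) -> LL_measurable X g ->
  exists2 nu : {measure set (lebesgue_space R d2) -> \bar R},
    pushforward_on X g = nu &
    forall f : lebesgue_space R d2 -> \bar R,
      measurable_fun setT f -> (forall x, 0 <= f x)%E ->
      (\int[nu]_x f x = \int[lebesgue]_(x in X) f (g x))%E.
Proof.
move=> mX mg; pose G : lebesgue_space R d1 -> lebesgue_space R d2 := g \_ X.
have mG : measurable_fun setT G by exact/(measurable_restrictT _ mX).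
have GE x : X x -> G x = g x by move=> Xx; rewrite /G patchT ?inE.
exists (pushforward (mrestr lebesgue mX) G).
  apply/funext => A; rewrite /pushforward_on /pushforward /lebesgue_on /mrestr.
  congr lebesgue; apply/seteqP; split=> x [Ax Xx]; split=> //.
    by rewrite /preimage/= GE.
  by move: Ax; rewrite /preimage/= GE.
move=> f mf f0; rewrite ge0_integral_pushforward//.
rewrite preimage_setT.
rewrite (@ge0_integral_mrestr _ _ _ (@lebesgue R d1) X mX (f \o G)); first last.
- by move=> x; exact: f0.
- exact: measurableT_comp.
by apply: eq_integral => x /set_mem Xx /=; rewrite GE.
Unshelve. exact: mG.
Qed.

Lemma Lq_norm_on_inftyP d (X : set 'rV[R]_d) (h : 'rV[R]_d -> \bar R) :
  (Lq_norm_on X +oo h < +oo)%E <->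
  exists M : R, \forall x \ae lebesgue, X x -> (`|h x| <= M%:E)%E.
Proof.
split=> [/Lnorm_infty_ltyP[M hM]|[M hM]].
  exists M; apply: filterS hM => x + Xx; by rewrite patchT ?inE.
(* [M] may be negative if [X] is null, but must also bound the extension by 0. *)
apply/Lnorm_infty_ltyP; exists (Num.max 0 M); apply: filterS hM => x hM.
rewrite /patch; case: ifPn => [/set_mem/hM /le_trans|_].
  by apply; rewrite lee_fin le_max lexx orbT.
by rewrite abse0 lee_fin le_max lexx.
Qed.

Lemma Lq_norm_on_finP d m (X : set 'rV[R]_d) (p : R) (f : 'rV[R]_d -> 'rV[R]_m) :
  0 < p ->
  (Lq_norm_on X p%:E (fun x => (euclidean_norm (f x))%:E) < +oo)%E <->
  (\int[@lebesgue R d]_(x in X) (euclidean_norm (f x) `^ p)%:E < +oo)%E.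
Proof.
move=> p0; apply: (iff_trans (Lnorm_fin_ltyP _ _ p0)).
rewrite [in X in _ <-> X]integral_mkcond.
rewrite [X in (X < _)%E <-> _](_ : _ = \int[@lebesgue R d]_x
  ((fun x => (euclidean_norm (f x) `^ p)%:E) \_ X) x)%E//.
apply: eq_integral => x _; rewrite /patch; case: ifPn => _.
  by rewrite gee0_abs ?lee_fin ?euclidean_norm_ge0 // poweR_EFin.
by rewrite abse0 poweR0r// gt_eqF.
Qed.
End on_subset.

(** * Bounded densities and vector-valued test functions *)

(** On the set B where the density is at least C+1, (C+1) mu(B) <= nu(B) <= C mu(B); as mu(B) is
    finite, it vanishes. *)
Lemma bounded_Radon_Nikodym d (T : measurableType d) (R : realType)
    (mu : {sigma_finite_measure set T -> \bar R})
    (nu : {measure set T -> \bar R}) (C : {nonneg R}) :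
  (nu setT < +oo)%E ->
  (forall A, measurable A -> (nu A <= C%:num%:E * mu A)%E) ->
  exists h : T -> \bar R, [/\ measurable_fun setT h, forall x, (0 <= h x)%E,
    forall A, measurable A -> nu A = (\int[mu]_(x in A) h x)%E &
    \forall x \ae mu, (h x <= (C%:num + 1)%:E)%E].
Proof.
move=> nuT nuC.
pose nuF := mfrestr measurableT nuT.
have nuFE : nuF = nu :> (set T -> \bar R).
  by apply/funext => A; rewrite /nuF /mfrestr /mrestr setIT.
have numu : nuF `<< mu.
  apply/null_content_dominatesP => A mA muA; apply/eqP.
  by rewrite nuFE -measure_le0 (le_trans (nuC _ mA))// muA mule0.
pose h := Radon_Nikodym_SigmaFinite.f nuF mu.
have h0 x : (0 <= h x)%E by exact: Radon_Nikodym_SigmaFinite.f_ge0.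
have mh : measurable_fun setT h.
  exact: measurable_int (Radon_Nikodym_SigmaFinite.f_integrable numu).
have nuE A : measurable A -> nu A = (\int[mu]_(x in A) h x)%E.
  by rewrite -nuFE; exact: (Radon_Nikodym_SigmaFinite.f_integral numu).
exists h; split => //.
pose B := [set x | ((C%:num + 1)%:E <= h x)%E].
have mB : measurable B.
  by rewrite -[B]setTI; exact: emeasurable_fun_c_infty.
have CB : ((C%:num + 1)%:E * mu B <= nu B)%E.
  rewrite nuE// -integral_cst//; apply: ge0_le_integral => //.
  - by move=> x _; rewrite lee_fin addr_ge0.
  - exact: measurable_funTS.
(* The added 1 keeps the coefficient positive even for C = 0, so finiteness of nu(B) passes to
   mu(B). *)
have muB : mu B \is a fin_num.
  have nuB : (nu B < +oo)%E by rewrite (le_lt_trans _ nuT)// le_measure ?inE.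
  rewrite ge0_fin_numE//; have := le_lt_trans CB nuB.
  by rewrite !ltey; apply: contraNN => /eqP->; rewrite gt0_muley ?lte_fin// ltr_wpDl.
exists B; split => //; last first.
  by move=> x /= /negP; rewrite -ltNge => /ltW.
have := le_trans CB (nuC _ mB).
rewrite -(fineK muB) -!EFinM lee_fin mulrDl mul1r gerDl => muB0.
by apply/eqP; rewrite eqe eq_le muB0 fine_ge0.
Qed.

Lemma measurable_scale_delta (R : realType) d m (X : set 'rV[R]_d) (i : 'I_m)
    (v : lebesgue_space R d -> R) :
  measurable_fun (X : set (lebesgue_space R d)) v ->
  LB_measurable X (fun x => v x *: delta_mx ord0 i : 'rV[R]_m).
Proof.
move=> mv.
have mi : measurable_fun setT
    ((fun t : R => t *: (delta_mx ord0 i : 'rV[R]_m)) : R -> borel_space R m).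
  by apply: measurable_into_borel => t; exact: scalel_continuous.
exact: (measurableT_comp mi mv).
Qed.

(** * Nonsingularity of [g] and the case of L^infinity *)

Section composition.
Context {R : realType} {d1 d2 m : nat}.
Variables (X1 : set 'rV[R]_d1) (X2 : set 'rV[R]_d2).
Hypotheses (mX1 : measurable (X1 : set (lebesgue_space R d1)))
           (mX2 : measurable (X2 : set (lebesgue_space R d2))).
Variable g : 'rV[R]_d1 -> 'rV[R]_d2.
Hypothesis gX : forall x, X1 x -> X2 (g x).

Let indic (i : 'I_m) (A : set 'rV[R]_d2) (x : 'rV[R]_d2) : 'rV[R]_m :=
  (\1_A x : R) *: delta_mx ord0 i.

(** Indicators are assumed admissible only for sets of finite measure, so that the same argument
    serves finite and infinite exponents. *)
Lemma comp_Lq_nonsingular (i : 'I_m) (q : \bar R) :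
  (forall A : set (lebesgue_space R d2), measurable A -> (lebesgue A < +oo)%E ->
    Lq_on X2 q (indic i A)) ->
  comp_Lq m X1 X2 q g ->
  LL_measurable X1 g /\ pushforward_on X1 g `<< lebesgue_on X2.
Proof.
move=> Lq_indic gq; have mg : LL_measurable X1 g.
  move=> _ A mA.
  have [F FT mF] := @lebesgue_sigma_finite R d2.
  rewrite -[A]setIT FT setI_bigcupr preimage_bigcup setI_bigcupr.
  apply: bigcupT_measurable => n; have [mFn Fnoo] := mF n.
  have mAF : measurable (A `&` F n) by exact: measurableI.
  have /gq[[mfg _] _] : Lq_on X2 q (indic i (A `&` F n)).
    apply: Lq_indic => //; apply: le_lt_trans Fnoo.
    by apply: le_measure; rewrite ?inE//; exact: subIsetr.
  have mc : measurable_fun setT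
      ((fun y : 'rV[R]_m => y ord0 i) : borel_space R m -> R).
    by apply: measurable_from_borel => y; exact: coord_continuous.
  (* On [X1], the [i]-th coordinate of the composition is 1 exactly on the preimage of [A]
     intersected with [F n]. *)
  have /(_ mX1 [set 1] (measurable_set1 _)) := measurableT_comp mc mfg.
  congr measurable; apply/seteqP; split=> x [X1x] /=.
    rewrite !mxE !eqxx mulr1 indicE; case: (boolP (g x \in _)) => [/set_mem//|_].
    by move=> /esym/eqP; rewrite oner_eq0.
  by move=> AFgx; split => //; rewrite !mxE !eqxx mulr1 indicE mem_set.
split=> // N N0 A mA AN.
(* The indicator of [A] represents the zero class on [X2], so its composition with [g] vanishes a.e.
   on [X1]: the preimage of [A] is null. *)
have /gq[_ /(_ (indic i A))] : Lq_on X2 q (indic i set0).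
  by apply: Lq_indic => //; rewrite measure0.
case.
  exists (A `&` X2); split; first exact: measurableI.
    exact: N0.
  move=> x /= /not_implyP[X2x]; rewrite /indic indic0 indicE.
  by case: (boolP (x \in A)) => [/set_mem//|].
move=> M [mM M0 subM]; apply/eqP; rewrite eq_le lebesgue_outer_ge0 andbT.
rewrite -M0; apply: le_lebesgue_outer => x [Agx X1x]; apply: subM => /=.
move=> /(_ X1x) /matrixP /(_ ord0 i); rewrite !mxE !eqxx !mulr1 indic0 indicE.
by rewrite mem_set//; apply/eqP; rewrite oner_eq0.
Qed.

(** Absolute continuity makes the preimage of the exceptional set null. This yields both
    independence of the representative and preservation of essential bounds. *)
Lemma ae_on_comp (P : 'rV[R]_d2 -> Prop) :
  LL_measurable X1 g -> pushforward_on X1 g `<< lebesgue_on X2 ->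
  (\forall y \ae lebesgue, X2 y -> P y) ->
  \forall x \ae lebesgue, X1 x -> P (g x).
Proof.
move=> mg ac [N [mN N0 subN]].
exists (X1 `&` g @^-1` N); split.
- exact: mg.
- rewrite setIC; apply: (ac N) => // A mA AN.
  apply/eqP; rewrite eq_le lebesgue_outer_ge0 andbT -N0.
  by apply: le_lebesgue_outer => x [/AN].
- move=> x /= /not_implyP[X1x nP]; split => //; apply: subN => /= /(_ (gX X1x)).
  exact: nP.
Qed.

(** An (L, B)-measurable map after an (L, L)-measurable one is (L, B)-measurable, and [ae_on_comp]
    handles classes; only the norm is left to estimate. *)
Lemma comp_Lq_of_norm (q : \bar R) :
  LL_measurable X1 g -> pushforward_on X1 g `<< lebesgue_on X2 ->
  (forall f : 'rV[R]_d2 -> 'rV[R]_m, Lq_on X2 q f ->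
    (Lq_norm_on X1 q (fun x => (euclidean_norm (f (g x)))%:E) < +oo)%E) ->
  comp_Lq m X1 X2 q g.
Proof.
move=> mg ac bnd f Lf; split; last by move=> f'; exact: ae_on_comp.
split; last exact: bnd.
have [mf _] := Lf; apply: (measurable_comp mX2 _ mf mg).
by move=> _ [x X1x <-]; exact: gX.
Qed.

Lemma nonsingular_comp_Linfty :
  LL_measurable X1 g -> pushforward_on X1 g `<< lebesgue_on X2 ->
  comp_Lq m X1 X2 +oo%E g.
Proof.
move=> mg ac; apply: comp_Lq_of_norm => // f [_ /Lq_norm_on_inftyP[M fM]].
by apply/Lq_norm_on_inftyP; exists M; exact: (ae_on_comp mg ac fM).
Qed.

Lemma Linfty_indic (i : 'I_m) (A : set (lebesgue_space R d2)) :
  measurable A -> Lq_on X2 +oo%E (indic i A).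
Proof.
move=> mA; split; first by apply: measurable_scale_delta; exact: measurable_indic.
apply/Lq_norm_on_inftyP; exists 1; apply: nearW => x _.
rewrite euclidean_norm_scale_delta /= normr_id lee_fin indicE.
by case: (_ \in _); rewrite ?normr1 ?normr0.
Qed.

Lemma Lp_indic (p : R) (i : 'I_m) (A : set (lebesgue_space R d2)) : 0 < p ->
  measurable A -> (lebesgue A < +oo)%E -> Lq_on X2 p%:E (indic i A).
Proof.
move=> p0 mA Aoo.
split; first by apply: measurable_scale_delta; exact: measurable_indic.
apply/Lq_norm_on_finP => //.
rewrite (eq_integral (fun x => (\1_A x)%:E)).
  rewrite integral_indic//; apply: le_lt_trans Aoo.
  by apply: le_measure; rewrite ?inE//; exact: measurableI.
move=> x _; rewrite euclidean_norm_scale_delta indicE.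
by case: (_ \in _); rewrite ?normr1 ?powR1// normr0 powR0// gt_eqF.
Qed.

End composition.

(** * Finite exponents: composition in L^p and bounded densities *)

Section finite_measure_domain.
Context {R : realType} {d1 d2 m : nat}.
Variables (X1 : set 'rV[R]_d1) (X2 : set 'rV[R]_d2).
Hypotheses (mX1 : measurable (X1 : set (lebesgue_space R d1)))
           (mX2 : measurable (X2 : set (lebesgue_space R d2))).
Variable g : 'rV[R]_d1 -> 'rV[R]_d2.
Hypothesis gX : forall x, X1 x -> X2 (g x).

(** [measure_le_mscale] applies because p-th roots of nonnegative integrable functions are
    admissible test functions in L^p. *)
Lemma comp_Lp_bounded_density (i : 'I_m) (p : R) : 0 < p ->
  (lebesgue X1 < +oo)%E -> comp_Lq m X1 X2 p%:E g ->
  LL_measurable X1 g -> pushforward_on X1 g `<< lebesgue_on X2 ->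
  exists h : 'rV[R]_d2 -> \bar R,
    is_Radon_Nikodym X2 (pushforward_on X1 g) h /\
    (Lq_norm_on X2 +oo h < +oo)%E.
Proof.
move=> p0 X1oo gp mg ac.
have [nu nuE int_nu] := LL_measurable_pushforward mX1 mg.
have nuT : (nu setT < +oo)%E.
  by rewrite -nuE /pushforward_on /pushforward /lebesgue_on preimage_setT setTI.
(* Absolute continuity with respect to the restriction to [X2] passes to Lebesgue measure on the
   whole space, where the general lemmas apply. *)
have numu : nu `<< @lebesgue R d2.
  rewrite -nuE => N N0; apply: ac => A mA AN.
  apply/eqP; rewrite eq_le lebesgue_outer_ge0 andbT -(N0 _ mA AN).
  exact: le_lebesgue_outer.
have [|C nuC] := measure_le_mscale nuT numu.
  move=> f mf f0 foo.
  (* The p-th power of the norm of [F] is [f], so the L^p condition on [F] composed with [g] is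
     finiteness of the nu-integral of [f]. *)
  pose F (x : 'rV[R]_d2) : 'rV[R]_m := (f x `^ p^-1) *: delta_mx ord0 i.
  have normF x : euclidean_norm (F x) `^ p = f x.
    rewrite euclidean_norm_scale_delta ger0_norm ?powR_ge0//.
    by rewrite -powRrM mulVf ?gt_eqF// powRr1.
  have LF : Lq_on X2 p%:E F.
    split.
      apply: measurable_scale_delta; apply: measurable_funTS.
      exact: (measurableT_comp (measurable_powR p^-1) mf).
    apply/Lq_norm_on_finP => //; apply: le_lt_trans foo.
    rewrite [leLHS](eq_integral (fun x => (f x)%:E)); last first.
      by move=> x _; rewrite normF.
    apply: ge0_subset_integral => //; first exact/measurable_EFinP.
    by move=> x _; rewrite lee_fin.
  have [[_ /(Lq_norm_on_finP _ _ p0) Fg] _] := gp _ LF.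
  rewrite int_nu; last 2 first.
  - exact/measurable_EFinP.
  - by move=> x; rewrite lee_fin.
  move: Fg.
  rewrite (eq_integral (fun x : lebesgue_space R d1 => (f (g x))%:E))// => x _.
  by rewrite /= normF.
have [h [mh h0 hE hC]] := bounded_Radon_Nikodym nuT nuC.
exists h; split.
  split=> [|x _|B mB _]; [exact: measurable_funTS|exact: h0|].
  by rewrite nuE hE.
apply/Lq_norm_on_inftyP; exists (C%:num + 1); apply: filterS hC => x hx _.
by rewrite gee0_abs.
Qed.

(** A density bounded by C gives nu <= C L, hence the integral of |f|^p composed with [g] is at most
    C times that of |f|^p over [X2]. *)
Lemma bounded_density_comp_Lp (p : R) (h : 'rV[R]_d2 -> \bar R) : 0 < p ->
  LL_measurable X1 g -> pushforward_on X1 g `<< lebesgue_on X2 ->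
  is_Radon_Nikodym X2 (pushforward_on X1 g) h ->
  (Lq_norm_on X2 +oo h < +oo)%E ->
  comp_Lq m X1 X2 p%:E g.
Proof.
move=> p0 mg ac [mh h0 hE] /Lq_norm_on_inftyP[M hM].
have [nu nuE int_nu] := LL_measurable_pushforward mX1 mg.
have C0 : 0 <= Num.max 0 M by rewrite le_max lexx.
pose C := NngNum C0.
have nuC A : measurable A -> (nu A <= mscale C (@lebesgue R d2) A)%E.
  move=> mA; have mAX : measurable (A `&` X2 : set (lebesgue_space R d2)).
    exact: measurableI.
  (* The density represents nu only on subsets of [X2]; nu is carried by [X2] since [g] maps [X1]
     into it. *)
  have -> : nu A = nu (A `&` X2).
    rewrite -nuE /pushforward_on /pushforward /lebesgue_on; congr lebesgue.
    apply/seteqP; split=> [x [Agx X1x]|x [[Agx _] X1x]] //.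
    by split=> //; split=> //; exact: gX.
  rewrite -nuE hE//.
  apply: (@le_trans _ _ (\int[@lebesgue R d2]_(x in A `&` X2) (C%:num)%:E)%E).
    apply: ae_ge0_le_integral => //.
    - by move=> x [_ /h0].
    - exact: measurable_funS mh.
    - apply: filterS hM => x hx [_ X2x]; apply: (le_trans (lee_abs _)).
      by apply: (le_trans (hx X2x)); rewrite lee_fin le_max lexx orbT.
  rewrite integral_cst//; apply: lee_wpmul2l; first by rewrite lee_fin.
  by apply: le_measure; rewrite ?inE//; exact: subIsetl.
apply: comp_Lq_of_norm => // f [mf /(Lq_norm_on_finP _ _ p0) fp].
apply/Lq_norm_on_finP => //.
(* [f] is measurable only on [X2]; extension by 0 gives a total integrand with the same values along
   [g] on [X1]. *)
pose phi : lebesgue_space R d2 -> \bar R :=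
  (fun y => (euclidean_norm (f y) `^ p)%:E) \_ X2.
have mnf : measurable_fun (X2 : set (lebesgue_space R d2))
    (fun y => (euclidean_norm (f y) `^ p)%:E).
  apply/measurable_EFinP; apply: (measurableT_comp (measurable_powR p)).
  exact: (measurableT_comp measurable_euclidean_norm mf).
have mphi : measurable_fun setT phi by exact/(measurable_restrictT _ mX2).
have phi0 y : (0 <= phi y)%E.
  by apply: erestrict_ge0 => x _; rewrite lee_fin powR_ge0.
rewrite (eq_integral (fun x : lebesgue_space R d1 => phi (g x))); last first.
  by move=> x /set_mem X1x; rewrite /phi patchT// inE; exact: gX.
rewrite -int_nu//.
apply: (@le_lt_trans _ _ (\int[mscale C (@lebesgue R d2)]_x phi x)%E).
  exact: ge0_le_measure_integral.
rewrite ge0_integral_mscale// lte_mul_pinfty//.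
by rewrite -integral_mkcond; exact: fp.
Qed.

End finite_measure_domain.

(** * The two equivalences for open sets *)

Theorem theorem2p9 (R : realType) (d1 d2 m : nat)
    (d1_gt0 : (0 < d1)%N) (d2_gt0 : (0 < d2)%N) (m_gt0 : (0 < m)%N)
    (X1 : set 'rV[R]_d1) (X2 : set 'rV[R]_d2)
    (openX1 : open X1) (openX2 : open X2)
    (g : 'rV[R]_d1 -> 'rV[R]_d2) (gX : forall x, X1 x -> X2 (g x)) :
  (comp_Lq m X1 X2 +oo%E g <->
     LL_measurable X1 g /\ pushforward_on X1 g `<< lebesgue_on X2)
  /\
  ((lebesgue X1 < +oo)%E ->
   forall p : R, 1 <= p ->
   (comp_Lq m X1 X2 p%:E g <->
      [/\ LL_measurable X1 g,
          pushforward_on X1 g `<< lebesgue_on X2 &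
          exists h : 'rV[R]_d2 -> \bar R,
            is_Radon_Nikodym X2 (pushforward_on X1 g) h /\
            (Lq_norm_on X2 +oo h < +oo)%E])).
Proof.
have mX1 := open_lebesgue_measurable openX1.
have mX2 := open_lebesgue_measurable openX2.
(* Positivity of [m] supplies a coordinate axis to carry the scalar test functions. *)
pose i := Ordinal m_gt0.
split.
  split=> [|[mg ac]]; last exact: nonsingular_comp_Linfty.
  by apply: (comp_Lq_nonsingular mX1 mX2 (i := i)) => A mA _; exact: Linfty_indic.
move=> X1oo p p1; have p0 : 0 < p by exact: lt_le_trans p1.
split=> [gp|[mg ac [h [hRN hoo]]]]; last exact: bounded_density_comp_Lp hRN hoo.
have [|mg ac] := comp_Lq_nonsingular mX1 mX2 (i := i) _ gp.
  by move=> A; exact: Lp_indic.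
by split => //; exact: (comp_Lp_bounded_density mX1 mX2 i p0).
Qed.
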